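(* Let $[\omega]^\omega$ be equipped with a segment topology. Then the $\sigma$-field $(v)$ coincides with the family of all subsets of $[\omega]^\omega$ which have the Baire property with respect to this segment topology.
   Context: $[\omega]^\omega$ is the family of all infinite subsets of $\omega$; $\mathfrak{c}$ is the cardinality of the continuum. For $A \subseteq B \subseteq \omega$ with $B\setminus A$ infinite, the set $\langle A,B\rangle = \{X \in [\omega]^\omega : A \subseteq X \subseteq B\}$ is called a segment. A set $S \subseteq [\omega]^\omega$ is a $v$-set if for each segment $\langle A,B\rangle$ there is a segment $\langle C,D\rangle \subseteq \langle A,B\rangle$ with $\langle C,D\rangle \subseteq S$ or $\langle C,D\rangle \cap S = \emptyset$. The family of all $v$-sets is a $\sigma$-field, denoted $(v)$. Segment topologies: fix a transfinite sequence $\{C_\alpha : \alpha < \mathfrak{c}\}$ consisting of all segments. For $\alpha < \mathfrak{c}$ let $M_\alpha$ be the union of all finite intersections $C_{\beta_1}\cap\dots\cap C_{\beta_n}$ ($n\ge 1$, all $\beta_i \le \alpha$) such that $C_{\beta_1}\cap\dots\cap C_{\beta_n}$ is finite, and put $V_\alpha = C_\alpha \setminus M_\alpha$ (so $V_0 = C_0$). The topology on $[\omega]^\omega$ generated by all the sets $V_\alpha$, $\alpha<\mathfrak{c}$ (taken as a subbase), is called a segment topology; it depends on the chosen sequence. A subset $Y$ of a topological space has the Baire property if $Y = (G\setminus F)\cup H$ with $G$ open and $F$, $H$ of the first category. *)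

(* Defs.v *)
From HB Require Import structures.
From mathcomp Require Import all_boot all_order.
From mathcomp Require Import all_classical topology.

Set Implicit Arguments.
Unset Strict Implicit.
Unset Printing Implicit Defensive.

Local Open Scope classical_set_scope.
Local Open Scope card_scope.

Definition infsub : Type := set_type [set X : set nat | infinite_set X].
HB.instance Definition _ := Choice.on infsub.

Definition segment (A B : set nat) : set infsub :=
  [set X : infsub | A `<=` val X /\ val X `<=` B].

Definition segments : set (set infsub) :=
  [set S | exists A B : set nat,
     [/\ A `<=` B, infinite_set (B `\` A) & S = segment A B]].

Definition v_set (S : set infsub) : Prop :=
  forall P, segments P ->
    exists Q, [/\ segments Q, Q `<=` P & Q `<=` S \/ Q `&` S = set0].

Definition v_field : set (set infsub) := [set S | v_set S].

(* [I] is order-isomorphic to the ordinal c (the least ordinal of cardinality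
   2^aleph_0): a well-order of that cardinality all of whose proper initial
   segments have strictly smaller cardinality.  Families over such an [I] are
   the transfinite sequences indexed by the ordinals below c. *)
Definition continuum_ordinal (d : Order.disp_t) (I : orderType d) : Prop :=
  [/\ wochoice.well_order (Order.le : rel I),
      [set: I] #= [set: set nat]
    & forall a : I, ~ ([set: I] #<= [set b : I | (b < a)%O])].

Definition segment_removed (d : Order.disp_t) (I : orderType d)
    (C : I -> set infsub) (a : I) : set infsub :=
  \bigcup_(J in [set J : set I | [/\ J !=set0, finite_set J,
                                     J `<=` [set b | (b <= a)%O]
                                   & finite_set (\bigcap_(b in J) C b)]])
    \bigcap_(b in J) C b.

Definition segment_subbase (d : Order.disp_t) (I : orderType d)
    (C : I -> set infsub) (a : I) : set infsub :=
  C a `\` segment_removed C a.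

(* A copy of [infsub] depending on [C], so that each sequence [C] determines
   its own canonical topology. *)
Definition segment_space (d : Order.disp_t) (I : orderType d)
  (C : I -> set infsub) : Type := infsub.
HB.instance Definition _ (d : Order.disp_t) (I : orderType d)
  (C : I -> set infsub) := Choice.on (segment_space C).
HB.instance Definition _ (d : Order.disp_t) (I : orderType d)
  (C : I -> set infsub) :=
  isSubBaseTopological.Build (segment_space C)
    (range (segment_subbase C)) id.

Definition nowhere_dense (T : topologicalType) (N : set T) : Prop :=
  interior (closure N) = set0.

Definition first_category (T : topologicalType) (S : set T) : Prop :=
  exists N : nat -> set T,
    (forall n, nowhere_dense (N n)) /\ S = \bigcup_n N n.

Definition baire_property (T : topologicalType) (Y : set T) : Prop :=
  exists G F H : set T,
    [/\ open G, first_category F, first_category H & Y = (G `\` F) `|` H].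

(* Main.v *)
(* A set is nowhere dense for a segment topology iff it is null, i.e. below every
   segment there is a segment missing it: every segment contains a nonempty open
   set and conversely.  For this one needs that below every segment there is a
   segment missing the removed set M_a.  Each member of M_a that lies in
   <A u X, A u X u Y> is almost covered by finitely many lower bounds of the
   segments C_b, b <= a, so one of these lower bounds meets X in an infinite set
   and is contained in A u X u Y.  When X runs through continuum many almost
   disjoint sets, this lower bound determines X, while there are fewer than
   continuum many b <= a; no cardinal arithmetic is needed.  Null sets form a
   sigma-ideal by a fusion argument, so they are also the sets of the first
   category, and both inclusions follow. *)

Require Import Defs.
From mathcomp Require Import all_boot all_order all_classical topology.

Set Implicit Arguments.
Unset Strict Implicit.
Unset Printing Implicit Defensive.

Local Open Scope classical_set_scope.

(** * Null sets and the fusion argument *)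

Definition v_null (N : set infsub) : Prop :=
  forall P, segments P -> exists Q, [/\ segments Q, Q `<=` P & Q `&` N = set0].

Definition infset (X : set nat) (hX : infinite_set X) : infsub :=
  exist _ X (mem_set hX).

Lemma infsub_infinite (X : infsub) : infinite_set (val X).
Proof. exact: set_mem (valP X). Qed.

Lemma sub_infinite (T : Type) (A B : set T) :
  A `<=` B -> infinite_set A -> infinite_set B.
Proof. by move=> AB iA fB; apply: iA; exact: sub_finite_set AB fB. Qed.

Lemma segments_sub A B : A `<=` B -> infinite_set (B `\` A) ->
  segments (segment A B).
Proof. by move=> AB iAB; exists A, B. Qed.

Lemma segmentS A B A' B' : A `<=` A' -> B' `<=` B ->
  segment A' B' `<=` segment A B.
Proof.
move=> AA BB X [h1 h2]; split; first exact: subset_trans h1.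
exact: subset_trans h2 BB.
Qed.

(** [B'] is itself a member of the smaller segment. A point of [A] outside [A'] could be deleted
    from [B'], which gives a member that violates the lower bound [A]. *)
Lemma segment_subP A B A' B' : A' `<=` B' -> infinite_set (B' `\` A') ->
  segment A' B' `<=` segment A B -> A `<=` A' /\ B' `<=` B.
Proof.
move=> AB' iAB sub.
have iB : infinite_set B' by apply: sub_infinite iAB; exact: subDsetl.
split; last by have [] := sub (infset iB) (conj AB' (@subset_refl _ B')).
move=> x Ax; apply: contrapT => nA'x.
have iBx : infinite_set (B' `\ x) by apply: infinite_setD => //; exact: finite_set1.
have hx : segment A' B' (infset iBx).
  split=> [y A'y|y []//]; split; first exact: AB'.
  by move=> /= yx; apply: nA'x; rewrite -yx.
by have [/(_ x Ax) [_ /(_ erefl)]] := sub _ hx.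
Qed.

Lemma v_null_segment N A B : v_null N -> A `<=` B -> infinite_set (B `\` A) ->
  exists A' B', [/\ A `<=` A', A' `<=` B', B' `<=` B, infinite_set (B' `\` A') &
    segment A' B' `<=` ~` N].
Proof.
move=> hN AB iAB.
have [Q [[A' [B' [AB' iAB' ->]]] QP /disjoints_subset QN]] :=
  hN _ (segments_sub AB iAB).
by have [AA BB] := segment_subP AB' iAB' QP; exists A', B'.
Qed.

(* The points of [l] stay undecided: one shrinks once for each decision about
   each of them, and then puts them back into the difference. *)
Lemma v_null_segment_keep N (l : seq nat) A B : v_null N -> uniq l ->
  A `<=` B -> infinite_set (B `\` A) -> [set` l] `<=` B `\` A ->
  exists A' B', [/\ A `<=` A', A' `<=` B', B' `<=` B, infinite_set (B' `\` A') &
    [set` l] `<=` B' `\` A' /\ segment A' B' `<=` ~` N].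
Proof.
move=> hN; elim: l A B => [|k l IH] A B /=.
  move=> _ AB iAB _.
  have [A' [B' [h1 h2 h3 h4 h5]]] := v_null_segment hN AB iAB.
  by exists A', B'; split=> //; split=> // x.
move=> /andP[kl ul] AB iAB lAB.
have [Bk nAk] : (B `\` A) k by apply: lAB; rewrite /= inE eqxx.
have nek x : x \in l -> x <> k by move=> xl xk; move: kl; rewrite -xk xl.
have lAB' x : x \in l -> (B `\` A) x by move=> xl; apply: lAB; rewrite /= inE xl orbT.
(* Decide first the sets that contain [k]. *)
have [||| A1 [B1 [AA1 AB1 BB1 iAB1 [lAB1 N1]]]] := IH (A `|` [set k]) B ul.
- by move=> x [/AB//|->].
- by rewrite -setDDl; apply: infinite_setD => //; exact: finite_set1.
- move=> x /= xl; have [Bx nAx] := lAB' x xl; split=> // -[//|]; exact: nek.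
have A1k : A1 k by apply: AA1; right.
(* Then the sets that omit [k], which is deleted from both bounds just found. *)
have [||| A2 [B2 [AA2 AB2 BB2 iAB2 [lAB2 N2]]]] := IH (A1 `\ k) (B1 `\ k) ul.
- by move=> x [/AB1].
- apply: sub_infinite iAB1 => x [B1x nA1x]; split; last by move=> [].
  by split=> // xk; apply: nA1x; rewrite xk.
- move=> x xl; have [B1x nA1x] := lAB1 x xl; split; last by move=> [].
  by split=> //; exact: nek.
(* Added to the upper bound only, [k] becomes undecided again. *)
exists A2, (B2 `|` [set k]); split.
- move=> x Ax; apply: AA2; split; first by apply: AA1; left.
  by move=> xk; apply: nAk; rewrite -xk.
- by move=> x /AB2; left.
- by move=> x [/BB2[/BB1//]|->].
- by apply: sub_infinite iAB2 => x [B2x nA2x]; split=> //; left.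
split=> [x /=|X [A2X XB2]].
  rewrite inE => /predU1P[->|/lAB2[]]; last by move=> ? ?; split=> //; left.
  by split; [right|move=> /AB2/BB2[_]; exact].
(* Members containing [k] lie in [segment A1 B1], the others in [segment A2 B2]. *)
have [Xk|nXk] := pselect (val X k).
  apply: N1; split=> x.
    by have [->//|/eqP xk A1x] := eqVneq x k; apply: A2X; apply: AA2.
  by move=> /XB2[/BB2[]//|->]; exact: AB1.
apply: N2; split=> // x Xx; have [//|xk] := XB2 x Xx.
by case: nXk; rewrite -xk.
Qed.

(* Fusion: a decreasing sequence of segments, the n-th one missing [N n], in
   which one more point of the difference is kept for ever at each step. *)
Lemma v_null_bigcup (N : nat -> set infsub) :
  (forall n, v_null (N n)) -> v_null (\bigcup_n N n).
Proof.
move=> hN P [A [B [AB iAB ->]]].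
(* A state consists of a lower bound, an upper bound and the list of points kept undecided so
   far. *)
pose inv (s : set nat * set nat * seq nat) := [/\ s.1.1 `<=` s.1.2,
  infinite_set (s.1.2 `\` s.1.1), uniq s.2 & [set` s.2] `<=` s.1.2 `\` s.1.1].
pose R n (s s' : set nat * set nat * seq nat) := [/\ inv s', s.1.1 `<=` s'.1.1,
  s'.1.2 `<=` s.1.2, segment s'.1.1 s'.1.2 `<=` ~` N n &
  exists k, s'.2 = k :: s.2].
have step n s : exists s', inv s -> R n s s'.
  (* Without the invariant [s] is a default value, so that a total step function can be chosen. *)
  have [hs|] := pselect (inv s); last by exists s.
  case: s hs => [[A0 B0] l] hs; case: (hs) => /= AB0 iAB0 ul lAB0.
  have [A1 [B1 [AA1 AB1 BB1 iAB1 [lAB1 N1]]]] :=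
    v_null_segment_keep (hN n) ul AB0 iAB0 lAB0.
  have [k [[B1k nA1k] kl]] : exists k, (B1 `\` A1) k /\ k \notin l.
    apply: contrapT => nk; apply: iAB1; apply: sub_finite_set (finite_seq l).
    move=> x xAB; apply: contrapT => /negP xl; apply: nk; by exists x.
  exists (A1, B1, k :: l) => _; split=> //=; last by exists k.
  split=> //=; first by rewrite kl.
  by move=> x /=; rewrite inE => /predU1P[->//|]; exact: lAB1.
have /choice[f fP] : forall ns : nat * (set nat * set nat * seq nat),
    exists s', inv ns.2 -> R ns.1 ns.2 s' by move=> [n s]; exact: step.
pose s := fix s n := if n is m.+1 then f (m, s m) else (A, B, [::]).
have sinv n : inv (s n).
  elim: n => [|n IH]; first by split=> //= x.
  by have [] := fP (n, s n) IH.
have sR n : R n (s n) (s n.+1) := fP (n, s n) (sinv n).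
have sA m n : (m <= n)%N -> (s m).1.1 `<=` (s n).1.1.
  move=> /subnK <-; elim: (n - m)%N => [//|j IH].
  by apply: subset_trans IH _; have [] := sR (j + m)%N.
have sB m n : (m <= n)%N -> (s n).1.2 `<=` (s m).1.2.
  move=> /subnK <-; elim: (n - m)%N => [//|j IH].
  by apply: subset_trans IH; have [] := sR (j + m)%N.
have sl m n : (m <= n)%N -> [set` (s m).2] `<=` [set` (s n).2].
  move=> /subnK <-; elim: (n - m)%N => [//|j IH].
  apply: subset_trans IH _ => x /= xl.
  have [_ _ _ _ [k kE]] := sR (j + m)%N.
  by move: kE => /= ->; rewrite inE xl orbT.
have ssize n : size (s n).2 = n.
  by elim: n => [//|n IH]; have [_ _ _ _ [k ->]] := sR n; rewrite /= IH.
pose A' := \bigcup_n (s n).1.1; pose B' := \bigcap_n (s n).1.2.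
have AB' : A' `<=` B'.
  move=> x [m _ Amx] n _.
  apply: (sB n (maxn m n)); first exact: leq_maxr.
  have [/(_ x) h _ _ _] := sinv (maxn m n); apply: h.
  by apply: (sA m) Amx; exact: leq_maxl.
have lAB' n : [set` (s n).2] `<=` B' `\` A'.
  move=> x xl; split=> [m _|[m _ Amx]].
    apply: (sB m (maxn m n)); first exact: leq_maxl.
    have [_ _ _ /(_ x) h] := sinv (maxn m n).
    by have [] := h (sl n (maxn m n) (leq_maxr _ _) _ xl).
  have [_ _ _ /(_ x) h] := sinv (maxn m n).
  have [_] := h (sl n (maxn m n) (leq_maxr _ _) _ xl); apply.
  by apply: (sA m) Amx; exact: leq_maxl.
(* Stage [(size t).+1] has kept that many distinct points, too many for a list [t] of the whole
   difference. *)
have iAB' : infinite_set (B' `\` A').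
  move=> /finite_seqP[t tE].
  have [_ _ us _] := sinv (size t).+1.
  have : {subset (s (size t).+1).2 <= t}.
    by move=> x /(lAB' (size t).+1 x); rewrite tE.
  by move=> /(uniq_leq_size us); rewrite ssize ltnn.
exists (segment A' B'); split; first exact: segments_sub.
  by apply: segmentS; [move=> x Ax; exists 0%N|move=> x /(_ 0%N I)].
apply/disjoints_subset => X [A'X XB'] [n _]; have [_ _ _ h _] := sR n; apply: h.
split; first by move=> x Ax; apply: A'X; exists n.+1.
by move=> x /XB' /(_ n.+1 I).
Qed.

(** * Finite segments, almost disjoint sets and the index order *)

(** A member is determined by its trace on the finite difference of the bounds, recorded as a tuple
    of booleans. *)
Lemma finite_segment A B : finite_set (B `\` A) -> finite_set (segment A B).
Proof.
move=> /finite_seqP[l lE].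
pose f (X : infsub) := map_tuple (fun i => `[< val X i >]) (in_tuple l).
have finj : {in segment A B &, injective f}.
  have fle X Y : segment A B X -> segment A B Y -> f X = f Y -> val X `<=` val Y.
    move=> [AX XB] [AY YB] /(congr1 val) /= /eq_in_map fXY x Xx.
    have [|nAx] := pselect (A x); first exact: AY.
    have xl : [set` l] x by rewrite -lE; split=> //; exact: XB.
    by have /asboolP := Xx; rewrite (fXY x xl) => /asboolP.
  move=> X Y /set_mem hX /set_mem hY fXY; apply: val_inj.
  by apply/seteqP; split; apply: fle.
rewrite -(eq_finite_set (inj_card_eq finj)).
exact: finite_finset.
Qed.

Lemma infinite_range (T : Type) (g : nat -> T) :
  injective g -> infinite_set (range g).
Proof.
move=> ginj fg; apply: infinite_nat.
have -> : [set: nat] = g @^-1` range g by apply/seteqP; split=> // x _; exists x.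
by apply: finite_preimage fg => x y _ _; exact: ginj.
Qed.

(* The members are the branches of the binary tree, coded in [D]. *)
Lemma almost_disjoint_family (D : set nat) : infinite_set D ->
  exists (X : set nat -> set nat) (Y : set nat),
  [/\ Y `<=` D, infinite_set Y, forall t, X t `<=` D `\` Y,
      forall t, infinite_set (X t) &
      forall t u, t <> u -> finite_set (X t `&` X u)].
Proof.
move=> /infiniteP/ppcard_leP[f].
have finj : injective f by move=> x y; apply: (@inj _ _ _ f); rewrite inE.
have fD x : D (f x) by exact: funS.
(* The node of length [n] on the branch [t], as a natural number. *)
pose code (t : set nat) n := pickle [seq `[< t i >] | i <- iota 0 n].
have codeE t u m n : code t m = code u n -> m = n /\
    forall i, (i < n)%N -> t i = u i.
  move=> /(pcan_inj pickleK) e; have mn : m = n.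
    by have := congr1 size e; rewrite !size_map !size_iota.
  split=> // i i_n; rewrite mn in e; move/eq_in_map: e => e.
  by rewrite -(asboolE (t i)) -(asboolE (u i)) e ?mem_iota.
(* Even positions in [D] carry the branches, odd positions form [Y]. *)
exists (fun t => range (fun n => f (code t n).*2)), (range (fun n => f n.*2.+1)).
split=> [_ [n _ <-]//||t _ [n _ <-]|t|t u tu].
- by apply: infinite_range => m n /finj [] /double_inj.
- split=> // -[m _ /finj /(congr1 odd)] /=; by rewrite !odd_double.
- by apply: infinite_range => m n /finj /double_inj /codeE[].
have [i tui] : exists i, t i <> u i.
  by apply: contra_notP tu => /forallNP h; apply/funext => i; apply: contrapT; exact: h.
(* Branches that differ at [i] share only nodes of length at most [i]. *)
apply: (@sub_finite_set _ _ ((fun n => f (code t n).*2) @` `I_i.+1)).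
  move=> _ [[m _ <-] [n _ /finj /double_inj /esym /codeE[mn eqtu]]].
  exists m => //=; rewrite ltnS leqNgt; apply/negP => im.
  by apply: tui; apply: eqtu; rewrite -mn.
by apply: finite_image; exact: finite_II.
Qed.

(** [continuum_ordinal] controls strict initial segments only. The extra point [a] is a value of [g]
    at no more than one [t0], so precomposing [g] with an injection that avoids [t0] leads into the
    strict initial segment. *)
Lemma no_injection_le (d : Order.disp_t) (I : orderType d) (a : I) :
  continuum_ordinal I ->
  ~ exists g : set nat -> I, injective g /\ forall t, (g t <= a)%O.
Proof.
move=> [_ Ic small] [g [ginj ga]]; apply: (small a).
have [t0 gt0] : exists t0, forall t, g t = a -> t = t0.
  have [[t0 e]|ne] := pselect (exists t0, g t0 = a).
    by exists t0 => t e'; apply: ginj; rewrite e.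
  by exists set0 => t e; case: ne; exists t.
(* [h] makes room: each [h t] differs from [t0] at 0. *)
pose h (t : set nat) : set nat := fun n => if n is m.+1 then t m else ~ t0 0%N.
have hinj : injective h.
  by move=> t u htu; apply/funext => m; exact: (congr1 (fun s => s m.+1) htu).
have ht0 t : h t <> t0.
  move=> /(congr1 (fun s => s 0%N)) /= e.
  have n0 : ~ t0 0%N by move=> t00; move: (t00); rewrite -e.
  by case: (n0); rewrite -e.
apply: (card_le_trans (B := [set: set nat])).
  by move: Ic; rewrite card_eq_le => /andP[].
have -> : [set: set nat] = (g \o h) @^-1` [set b | (b < a)%O].
  apply/seteqP; split=> // t _ /=; rewrite Order.POrderTheory.lt_neqAle ga andbT.
  by apply/eqP => /gt0; exact: ht0.
by apply: card_ge_preimage => t u _ _ /ginj /hinj.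
Qed.

Lemma finite_max (d : Order.disp_t) (I : orderType d) (J : set I) :
  finite_set J -> J !=set0 -> exists2 m, J m & forall j, J j -> (j <= m)%O.
Proof.
move=> /finite_seqP[l ->]; elim: l => [[]//|a [|b l] IH _].
  by exists a => [|j]; rewrite /= inE // => /eqP ->.
have [|m ml mmax] := IH; first by exists b; rewrite /= inE eqxx.
exists (Order.max a m).
  by case: Order.TotalTheory.leP => _; rewrite /= in_cons ?eqxx //;
    rewrite ml orbT.
move=> j /=; rewrite in_cons => /predU1P[->|/mmax jm].
  by rewrite Order.TotalTheory.le_max Order.POrderTheory.lexx.
by rewrite Order.TotalTheory.le_max jm orbT.
Qed.

(** * Segments and open sets of the segment topology *)

Section segment_space.
Context (d : Order.disp_t) (I : orderType d) (C : I -> set infsub).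
Hypotheses (hI : continuum_ordinal I) (hC : range C = segments).

Lemma segment_bounds : exists LU : I -> set nat * set nat,
  forall b, C b = segment (LU b).1 (LU b).2.
Proof.
have /choice[LU CE] : forall b, exists AB : set nat * set nat,
    C b = segment AB.1 AB.2.
  move=> b; have : segments (C b) by rewrite -hC; exists b.
  by move=> [A [B [_ _ ->]]]; exists (A, B).
by exists LU.
Qed.

Lemma segment_index P : segments P -> exists a, C a = P.
Proof. by rewrite -hC => -[a _ <-]; exists a. Qed.

(* Removing from [Z] a point of this difference does not leave the intersection. *)
Lemma finite_setD_lower (LU : I -> set nat * set nat) (J : set I) (Z : infsub) :
  (forall b, C b = segment (LU b).1 (LU b).2) ->
  (\bigcap_(b in J) C b) Z -> finite_set (\bigcap_(b in J) C b) ->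
  finite_set (val Z `\` \bigcup_(b in J) (LU b).1).
Proof.
move=> CE CZ fC; set E := val Z `\` _.
have iZk k : infinite_set (val Z `\ k).
  by apply: infinite_setD; [exact: infsub_infinite|exact: finite_set1].
have finj : {in E &, injective (fun k => infset (iZk k))}.
  move=> j k /set_mem[Zj _] _ /(congr1 val) /= e; apply: contrapT => jk.
  by have [_ /(_ erefl)] : (val Z `\ j) j by rewrite e; split.
rewrite -(eq_finite_set (inj_card_eq finj)); apply: sub_finite_set fC.
move=> _ [k [Zk nk] <-] b Jb; have := CZ b Jb; rewrite CE => -[LZ ZU].
split=> x /=; last by move=> [/ZU].
by move=> Lx; split; [exact: LZ|move=> xk; apply: nk; exists b => //; rewrite -xk].
Qed.

Lemma segment_avoid_removed P a : segments P -> exists Q,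
  [/\ segments Q, Q `<=` P & Q `<=` ~` segment_removed C a].
Proof.
move=> [A [B [AB iAB ->]]].
have [X [Y [YD iY XDY iX Xad]]] := almost_disjoint_family iAB.
have [LU CE] := segment_bounds.
apply: contrapT => noQ; apply: (no_injection_le (a := a) hI).
have /choice[g gP] : forall t, exists b, [/\ (b <= a)%O,
    infinite_set ((LU b).1 `&` X t) & (LU b).1 `<=` A `|` X t `|` Y].
  (* Every member of [Q] contains [X t], and the points of [Y] stay undecided; by [noQ], [Q] meets
     the removed set. *)
  move=> t; pose Q := segment (A `|` X t) (A `|` X t `|` Y).
  have [Z [AZ ZB] [J [_ fJ Ja fC] CZ]] : exists2 Z, Q Z & segment_removed C a Z.
    apply: contrapT => nZ; apply: noQ; exists Q; split.
    - apply: segments_sub; first by move=> x; left.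
      apply: sub_infinite iY => x Yx; split; first by right.
      by move=> [Ax|/XDY[]//]; have [_] := YD _ Yx; exact.
    - apply: segmentS; first by move=> x; left.
      by move=> x [[/AB//|/XDY[[]//]]|/YD[]].
    - by move=> Z QZ MZ; apply: nZ; exists Z.
  have fL := finite_setD_lower CE CZ fC.
  have [b [Jb iL]] : exists b, J b /\ infinite_set ((LU b).1 `&` X t).
    apply: contrapT => nb; apply: (iX t).
    apply: (@sub_finite_set _ _ ((val Z `\` \bigcup_(b in J) (LU b).1) `|`
        \bigcup_(b in J) ((LU b).1 `&` X t))).
      move=> x Xx; have [[b Jb Lx]|nL] := pselect ((\bigcup_(b in J) (LU b).1) x).
        by right; exists b.
      by left; split=> //; apply: AZ; right.
    rewrite finite_setU; split=> //; apply: bigcup_finite => // b Jb.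
    by apply: contrapT => iL; apply: nb; exists b.
  exists b; split=> //; first exact: Ja.
  by have := CZ b Jb; rewrite CE => -[LZ _] x /LZ /ZB.
exists g; split; last by move=> t; have [] := gP t.
(* The common lower bound has infinitely many points in [X t] and lies in the union of [A], [X u]
   and [Y]. As [X t] avoids [A] and [Y], these points lie in [X u], against almost disjointness. *)
move=> t u gtu; apply: contrapT => tu.
have [_ it _] := gP t; have [_ _ Lu] := gP u.
apply: it; apply: sub_finite_set (Xad _ _ tu) => x [Lx Xx]; split=> //.
rewrite gtu in Lx; have [[_ nAx] nYx] := XDY _ _ Xx.
by have [[]|] := Lu _ Lx.
Qed.

Lemma segment_removed_mono a b : (a <= b)%O ->
  segment_removed C a `<=` segment_removed C b.
Proof.
move=> ab Z [J [J0 fJ Ja fC] CZ]; exists J => //; split=> // i /Ja /= ia.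
exact: Order.POrderTheory.le_trans ab.
Qed.

(** A basic neighbourhood of [x] is a finite intersection of sets [C b] minus their removed sets.
    The sets [C b] intersect in a segment, and the removed sets grow with the index, so it suffices
    to avoid the one at the largest index [m]. *)
Lemma open_sub_segment (G : set (segment_space C)) : open G -> G !=set0 ->
  exists2 Q, segments Q & Q `<=` G.
Proof.
move=> [D Dsub <-] [x [U DU Ux]].
have [F [Fsub Fx FG]] : exists F : seq (set infsub),
    [/\ forall V, V \in F -> range (segment_subbase C) V,
        forall V, V \in F -> V x &
        forall Z, (forall V, V \in F -> V Z) -> (\bigcup_(i in D) i) Z].
  have [F Fsub UE] := Dsub _ DU; exists (finmap.enum_fset F); split.
  - by move=> V /Fsub/set_mem.
  - by move: Ux; rewrite -UE.
  - by move=> Z FZ; exists U => //; rewrite -UE => V; exact: FZ.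
have sT : segments (segment set0 setT).
  by apply: segments_sub => //; rewrite setD0; exact: infinite_nat.
have [a0 _] := segment_index sT.
have /choice[idx idxP] : forall V : set infsub, exists a,
    V \in F -> V = segment_subbase C a.
  (* Outside [F], [a0] is a default value. *)
  move=> V; have [VF|_] := boolP (V \in F); last by exists a0.
  by have [a _ <-] := Fsub _ VF; exists a.
(* The empty intersection is the whole space, itself a segment. *)
have [[V0 V0F]|F0] := pselect ([set` F] !=set0); last first.
  by exists (segment set0 setT) => // Z _; apply: FG => V VF; case: F0; exists V.
pose J := idx @` [set` F].
have fJ : finite_set J by apply: finite_image; exact: finite_seq.
have J0 : J !=set0 by exists (idx V0), V0.
have [m Jm mmax] := finite_max fJ J0.
have Vx b : J b -> segment_subbase C b x.
  by move=> [V VF <-]; rewrite -idxP //; exact: Fx.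
have [LU CE] := segment_bounds.
pose L := \bigcup_(b in J) (LU b).1; pose R := \bigcap_(b in J) (LU b).2.
have LR : L `<=` R.
  move=> k [b /Vx[]]; rewrite CE => -[Lx _] _ /Lx xk c /Vx[].
  by rewrite CE => -[_ xR] _; exact: xR.
have sCJ : segment L R `<=` \bigcap_(b in J) C b.
  move=> Z [LZ ZR] b Jb; rewrite CE.
  split=> k; last by move=> /ZR; exact.
  by move=> Lk; apply: LZ; exists b.
have CJs : \bigcap_(b in J) C b `<=` segment L R.
  move=> Z CZ; split=> [k [b Jb]|k Zk b Jb];
    by have := CZ b Jb; rewrite CE => -[LZ ZR]; do [exact: LZ|exact: ZR].
have iLR : infinite_set (R `\` L).
  (* Otherwise the intersection over [J] is finite, so it is part of what is removed at [m]; but it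
     contains [x]. *)
  move=> /finite_segment fs; have [_ ] := Vx m Jm; apply.
  exists J; last by move=> b /Vx[].
  by split=> //; exact: sub_finite_set fs.
have [Q [sQ QLR Qm]] := segment_avoid_removed m (segments_sub LR iLR).
exists Q => // Z QZ; apply: FG => V VF; rewrite (idxP V VF); split.
  by apply: sCJ; [exact: QLR|exists V].
by move=> /(segment_removed_mono (mmax _ (ex_intro2 _ _ V VF erefl))); exact: Qm.
Qed.

(** [P] is some [C a], and a segment below [P] that avoids the removed set shows that the subbasic
    set at [a] is nonempty. *)
Lemma segment_sub_open P : segments P ->
  exists G : set (segment_space C), [/\ open G, G !=set0 & G `<=` P].
Proof.
move=> sP; have [a aP] := segment_index sP.
exists (segment_subbase C a); split.
- exists [set segment_subbase C a]; last by rewrite bigcup_set1.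
  move=> _ ->; exists (finmap.fset1 (segment_subbase C a)).
    by move=> V /finmap.fset1P VE; apply/mem_set; exists a; rewrite ?VE.
  by rewrite set_fset1 bigcap_set1.
- have [_ [[A [B [AB iAB ->]]] QP Qa]] := segment_avoid_removed a sP.
  have iB : infinite_set B by apply: sub_infinite iAB; exact: subDsetl.
  have hB : segment A B (infset iB) by split.
  by exists (infset iB); split; [rewrite aP; exact: QP|exact: Qa].
- by rewrite -aP => x [].
Qed.

(** * Category and the Baire property *)

Lemma nowhere_denseP (N : set (segment_space C)) : nowhere_dense N <-> v_null N.
Proof.
split=> [nN P sP|nN].
  have [G [oG [x Gx] GP]] := segment_sub_open sP.
  have [y [Gy nNy]] : (G `&` ~` closure N) !=set0.
    apply: contrapT => h; suff : G `<=` interior (closure N) by rewrite nN => /(_ x Gx).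
    rewrite -open_subsetE // => y Gy.
    by apply: contrapT => nNy; apply: h; exists y.
  have [||Q sQ QG] := @open_sub_segment (G `&` ~` closure N).
  - by apply: openI => //; rewrite openC; exact: closed_closure.
  - by exists y.
  exists Q; split=> //; first by move=> z /QG[/GP].
  by apply/disjoints_subset => z /QG[_ h] Nz; apply: h; exact: subset_closure.
apply/seteqP; split=> // x Nx.
have [||P sP PN] := @open_sub_segment (interior (closure N)).
- exact: open_interior.
- by exists x.
(* A segment inside the closure of [N] has a nonempty open subset missing [N], which is absurd. *)
have [Q [sQ QP /disjoints_subset QN]] := nN _ sP.
have [G [oG [y Gy] GQ]] := segment_sub_open sQ.
have : closure N y by apply: interior_subset; exact/PN/QP/GQ.
by move=> /(_ G (open_nbhs_nbhs (conj oG Gy)))[z [Nz /GQ /QN]].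
Qed.

Lemma first_category_v_null (N : set (segment_space C)) :
  first_category N -> v_null N.
Proof.
by move=> [F [nF ->]]; apply: v_null_bigcup => n; exact/nowhere_denseP.
Qed.

Lemma nowhere_dense_first_category (N : set (segment_space C)) :
  nowhere_dense N -> first_category N.
Proof.
move=> nN; exists (fun=> N); split=> //; apply/seteqP; split=> x; last by move=> [].
by exists 0%N.
Qed.

(** The part of [S] outside its interior is null: a segment inside [S] contains a nonempty open set,
    which lies in the interior, and a segment disjoint from [S] misses that part anyway. *)
Lemma v_set_baire (S : set (segment_space C)) : v_set S -> baire_property S.
Proof.
move=> vS; exists (interior S), set0, (S `\` interior S); split.
- exact: open_interior.
- by apply: nowhere_dense_first_category; rewrite /nowhere_dense closure0 interior0.
- apply/nowhere_dense_first_category/nowhere_denseP => P /vS[Q [sQ QP [QS|QS]]].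
    have [G [oG G0 GQ]] := segment_sub_open sQ.
    have [Q' sQ' QG] := open_sub_segment oG G0.
    exists Q'; split=> //; first by move=> x /QG/GQ/QP.
    have GS : G `<=` interior S by rewrite -open_subsetE // => y /GQ /QS.
    by apply/disjoints_subset => x /QG /GS ? [].
  exists Q; split=> //; move/disjoints_subset: QS => QS.
  by apply/disjoints_subset => x /QS nSx [].
- by rewrite setD0 setDUK //; exact: interior_subset.
Qed.

(** Take a nonempty open [V] in the given segment. If [V] meets [G], a segment in both can be shrunk
    off [F] and then lies in [S]; otherwise a segment in [V] shrunk off [H] misses [S]. *)
Lemma baire_v_set (S : set (segment_space C)) : baire_property S -> v_set S.
Proof.
move=> [G [F [H [oG /first_category_v_null nF /first_category_v_null nH ->]]]] P sP.
have [V [oV V0 VP]] := segment_sub_open sP.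
have [GV|GV] := pselect ((V `&` G) !=set0).
  have [P' sP' P'VG] := open_sub_segment (openI oV oG) GV.
  have [Q [sQ QP' /disjoints_subset QF]] := nF _ sP'.
  exists Q; split=> //; first by move=> x /QP'/P'VG[/VP].
  by left=> x Qx; left; split; [have [] := P'VG _ (QP' _ Qx)|exact: QF].
have [P' sP' P'V] := open_sub_segment oV V0.
have [Q [sQ QP' /disjoints_subset QH]] := nH _ sP'.
exists Q; split=> //; first by move=> x /QP'/P'V/VP.
right; apply/disjoints_subset => x Qx [[Gx _]|]; last exact: QH.
by apply: GV; exists x; split=> //; exact/P'V/QP'.
Qed.

End segment_space.

Theorem theorem7 (d : Order.disp_t) (I : orderType d) (C : I -> set infsub)
    (hI : continuum_ordinal I) (hC : range C = segments) :
  v_field = [set S : set (segment_space C) | baire_property S].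
Proof.
by apply/seteqP; split=> S; [exact: v_set_baire|exact: baire_v_set].
Qed.
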